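(* Let $n\ge 1$ be an integer. Then $$\frac{1}{n!}\sum_{\pi\in S_n}\mathrm{d}(\pi)=\frac{n^2-1}{3n}.$$
   Context: $S_n$ is the set of all permutations of $\{1,\dots,n\}$. For $\pi\in S_n$ the displacement of $\pi$ is $\mathrm{d}(\pi)=\frac1n\sum_{i=1}^n|i-\pi(i)|$. *)

(* Defs.v *)
From mathcomp Require Import all_boot all_order all_algebra all_fingroup.

Set Implicit Arguments.
Unset Strict Implicit.
Unset Printing Implicit Defensive.

Import GRing.Theory Num.Theory.
Local Open Scope ring_scope.

(* 'S_n permutes {0, ..., n-1} rather than {1, ..., n}; the common shift of
   both positions cancels in each difference. All values are rational. *)
Definition displacement (n : nat) (s : 'S_n) : rat :=
  n%:R^-1 * \sum_(i < n) `|(i : nat)%:R - (s i : nat)%:R|.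

(* Main.v *)
Require Import Defs.
From mathcomp Require Import all_boot all_order all_algebra all_fingroup.
From mathcomp Require Import ring.
Import GRing.Theory Num.Theory.
Local Open Scope ring_scope.

(** For fixed [i], the image [s i] of a uniformly random permutation [s] is
    uniformly distributed, so the average of [\sum_i |i - s i|] is
    [n^-1 * \sum_i \sum_j |i - j|], and this double sum is [(n^3 - n) / 3]. *)

(* The sum of [f (s i)] does not depend on [i] (translate by [tperm i k]), so
   summing it over all [i] multiplies it by [#|T|]; but [\sum_k f (s k)] is
   [\sum_k f k] for every [s]. *)
Lemma sum_perm_point (R : pzRingType) (T : finType) (f : T -> R) (i : T) :
  #|T|%:R * \sum_(s : {perm T}) f (s i) = #|T|`!%:R * \sum_k f k.
Proof.
have move_point k : \sum_(s : {perm T}) f (s k) = \sum_(s : {perm T}) f (s i).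
  rewrite (reindex_inj (mulgI (tperm i k))) /=.
  by apply: eq_bigr => s _; rewrite permM tpermR.
rewrite !mulr_natl -sumr_const -(eq_bigr _ (fun k _ => move_point k)).
have card_perms : #|{perm T}| = #|T|`!.
  rewrite -cardsT -card_perm; apply: eq_card => s; rewrite !inE.
  by apply/esym/subsetP => k _; rewrite inE.
rewrite exchange_big -card_perms -sumr_const; apply: eq_bigr => s _.
by rewrite [RHS](reindex_inj (@perm_inj _ s)).
Qed.

(** The reversal [rev_ord] turns the distances n, ..., 1 into 1, ..., n, a triangular sum. *)
Lemma sum_dist_last (n : nat) :
  2%:R * \sum_(i < n) `|i%:R - n%:R| = n%:R * (n%:R + 1) :> rat.
Proof.
under eq_bigr => i _ do rewrite distrC -natrB ?normr_nat ?(ltnW (ltn_ord i)) //.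
rewrite (reindex_inj rev_ord_inj) /=.
under eq_bigr => i _ do rewrite subKn //.
elim: n => [|n IHn]; first by rewrite big_ord0 mulr0 mul0r.
by rewrite big_ord_recr /= mulrDr IHn -natr1; ring.
Qed.

(** Growing the square from n to n + 1 adds a row and a column, equal by symmetry and each given by
    [sum_dist_last]; their common corner is 0. *)
Lemma sum_dist (n : nat) :
  3%:R * \sum_(i < n) \sum_(j < n) `|i%:R - j%:R| = n%:R ^+ 3 - n%:R :> rat.
Proof.
elim: n => [|n IHn]; first by rewrite big_ord0 mulr0 expr0n subrr.
rewrite big_ord_recr big_ord_recr /= subrr normr0 addr0.
under eq_bigr => i _ do rewrite big_ord_recr /=.
under [X in _ + X]eq_bigr => i _ do rewrite distrC.
rewrite big_split /=.
have := sum_dist_last n; set S := \sum_(i < n) `|_ - n%:R| => S_eq.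
rewrite -addrA -mulr2n -[S *+ 2]mulr_natl S_eq mulrDr IHn -natr1; ring.
Qed.

Theorem theorem2p1 (n : nat) (hn : (1 <= n)%N) :
  (n`!%:R)^-1 * \sum_(s : 'S_n) displacement s
    = (n%:R ^+ 2 - 1) / (3%:R * n%:R) :> rat.
Proof.
have n_neq0 : n%:R != 0 :> rat by rewrite pnatr_eq0 -lt0n.
have fact_neq0 : n`!%:R != 0 :> rat by rewrite pnatr_eq0 -lt0n fact_gt0.
rewrite -mulr_sumr exchange_big /=.
have sum_eq : n%:R * \sum_(i < n) \sum_(s : 'S_n) `|i%:R - (s i)%:R|
    = n`!%:R * \sum_(i < n) \sum_(j < n) `|i%:R - j%:R| :> rat.
  rewrite !mulr_sumr; apply: eq_bigr => i _.
  have := @sum_perm_point rat 'I_n (fun j => `|i%:R - j%:R|) i.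
  by rewrite card_ord.
have /(congr1 ( *%R n`!%:R)) := sum_dist n.
rewrite mulrCA -sum_eq; set S := \sum_(i < n) _ => S_eq.
have -> : S = n`!%:R * (n%:R ^+ 3 - n%:R) / (3%:R * n%:R).
  by rewrite -S_eq; field.
by field; rewrite n_neq0 fact_neq0.
Qed.
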